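(* Let $G$ be a finite simple graph such that its complement $\overline{G}$ consists of two odd holes without common vertices (that is, $\overline{G}$ is the disjoint union of two cycles, each of odd length $\geq 5$). Then $\alpha(G)=2$ and (a) $I_{\mathcal{Q}_G}$ is generated by quadratic binomials; (b) $I_{\mathcal{Q}_G}$ has no quadratic Gröbner bases (with respect to any monomial order); (c) $\mathcal{Q}_G$ is not normal.
   Context: $G$ is a graph on $[n]=\{1,\dots,n\}$. A subset $W\subset[n]$ is stable if no two distinct elements of $W$ form an edge of $G$ (the empty set and singletons are stable); $\alpha(G)$ is the largest cardinality of a stable set. With $\rho(W)=\sum_{j\in W}\mathbf{e}_j$, the stable set polytope $\mathcal{Q}_G\subset\mathbb{R}^n$ is the convex hull of the $\rho(W)$ for $W$ stable in $G$. A hole of a graph is an induced cycle of length $>3$. Let $K$ be a field. For an integral convex polytope $\mathcal{P}\subset\mathbb{R}^n$ with $\mathcal{P}\cap\mathbb{Z}^n=\{\mathbf{a}_1,\dots,\mathbf{a}_m\}$, the toric ring $K[\mathcal{P}]$ is the $K$-subalgebra of $K[x_1^{\pm1},\dots,x_n^{\pm1},t]$ generated by the $X^{\mathbf{a}_i}t$ (where $X^{\mathbf{a}}=x_1^{a_1}\cdots x_n^{a_n}$), and the toric ideal $I_{\mathcal{P}}$ is the kernel of the surjection $K[y_1,\dots,y_m]\to K[\mathcal{P}]$, $y_i\mapsto X^{\mathbf{a}_i}t$. The polytope $\mathcal{P}$ is called normal if $K[\mathcal{P}]$ is a normal domain. *)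

(* Defs.v *)
From HB Require Import structures.
From mathcomp Require Import all_boot all_order all_algebra.
From mathcomp Require Import fraction boolp reals.
From mathcomp Require Import mpoly.

Set Implicit Arguments.
Unset Strict Implicit.
Unset Printing Implicit Defensive.

Import Order.TTheory GRing.Theory Num.Theory.

Local Open Scope ring_scope.

(** * Graphs *)

Section Graphs.
Variable T : finType.
Implicit Types (e : rel T) (W C D : {set T}).

Definition complement e : rel T := fun x y => (x != y) && ~~ e x y.

Definition stable e W : bool :=
  [forall x in W, forall y in W, (x != y) ==> ~~ e x y].

Definition independence_number e : nat := \max_(W : {set T} | stable e W) #|W|.

(* [s] lists the vertices of the hole in cyclic order; the last condition says
   that the subgraph induced on them has no other edges than those of the
   cycle. *)
Definition is_hole e C : Prop :=
  exists s : seq T,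
    [/\ uniq s, (3 < size s)%N, C = [set x in s]
      & {in s &, forall x y, e x y = (next s x == y) || (next s y == x)}].

(* The whole graph is the disjoint union of two odd holes: they cover all the
   vertices and no edge joins one to the other. *)
Definition two_disjoint_odd_holes e : Prop :=
  exists C D : {set T},
    [/\ is_hole e C /\ odd #|C|, is_hole e D /\ odd #|D|,
        [disjoint C & D], C :|: D = [set: T]
      & {in C & D, forall x y, ~~ e x y && ~~ e y x}].

End Graphs.

(** * Stable set polytopes *)

Definition convex_hull (R : realType) (n : nat) (S : 'rV[R]_n -> Prop)
    (x : 'rV[R]_n) : Prop :=
  exists (k : nat) (v : 'I_k -> 'rV[R]_n) (c : 'I_k -> R),
    [/\ forall i, S (v i), forall i, 0 <= c i, \sum_i c i = 1
      & x = \sum_i c i *: v i].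

Definition rho (R : realType) (n : nat) (W : {set 'I_n}) : 'rV[R]_n :=
  \sum_(j in W) delta_mx 0 j.

Arguments rho R {n} W.

Definition stable_set_polytope (R : realType) (n : nat) (e : rel 'I_n) :
    'rV[R]_n -> Prop :=
  convex_hull (fun x => exists2 W : {set 'I_n}, stable e W & x = rho R W).

Arguments stable_set_polytope R {n} e.

Definition lattice_point (R : realType) (n : nat) (P : 'rV[R]_n -> Prop)
    (a : 'rV[int]_n) : Prop :=
  P (map_mx intr a).

(* [a_0, ..., a_(m-1)] lists the lattice points of [P] without repetition. *)
Definition lattice_enum (R : realType) (n : nat) (P : 'rV[R]_n -> Prop)
    (m : nat) (a : 'I_m -> 'rV[int]_n) : Prop :=
  injective a /\ forall v, lattice_point P v <-> exists i, v = a i.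

Definition indicator (n : nat) (W : {set 'I_n}) : 'rV[int]_n :=
  \row_j (j \in W)%:R.

(* The lattice points of a stable set polytope are 0/1 vectors, so that they do
   have an enumeration. *)
Lemma stable_set_polytope_enum (R : realType) (n : nat) (e : rel 'I_n) :
  exists (m : nat) (a : 'I_m -> 'rV[int]_n),
    lattice_enum (stable_set_polytope R e) a.
Proof.
pose A := [set W : {set 'I_n} |
  `[< lattice_point (stable_set_polytope R e) (indicator W) >]].
exists #|A|, (fun i => indicator (enum_val i)); split=> [i j eq_ij | v].
  apply/enum_val_inj/setP=> k; move/rowP/(_ k): eq_ij; rewrite !mxE => /eqP.
  by case: (k \in _); case: (k \in _).
split=> [Pv | [i ->]]; last first.
  by have := enum_valP i; rewrite inE => /asboolP.
have v01 j : v 0 j = (v 0 j != 0)%:R.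
  have [k [x [c [Sx c_ge0 c_sum]]]] := Pv => /rowP/(_ j).
  rewrite mxE summxE => vE.
  have x01 i : 0 <= x i 0 j <= 1.
    have [W _ ->] := Sx i; rewrite /rho summxE.
    have [jW | jW] := boolP (j \in W).
      rewrite (bigD1 j) //= big1 => [|l /andP[_ /negPf neq_lj]].
        by rewrite mxE !eqxx addr0 ler01 lexx.
      by rewrite mxE eq_sym neq_lj andbF.
    rewrite big1 ?lexx ?ler01 // => l lW; rewrite mxE andTb.
    by case: eqP => // jl; rewrite jl lW in jW.
  have v_ge0 : 0 <= (v 0 j)%:~R :> R.
    rewrite vE sumr_ge0 // => i _; rewrite mxE mulr_ge0 //.
    by case/andP: (x01 i).
  have v_le1 : (v 0 j)%:~R <= 1 :> R.
    rewrite vE -c_sum ler_sum // => i _; rewrite mxE ler_piMr //.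
    by case/andP: (x01 i).
  move: v_ge0 v_le1; rewrite ler0z -[1]/(1%:~R) ler_int.
  by case: (v 0 j) => [[|[|l]]|l].
have vE : v = indicator [set j | v 0 j != 0].
  by apply/rowP=> j; rewrite mxE inE -v01.
have vA : [set j | v 0 j != 0] \in A by rewrite inE; apply/asboolP; rewrite -vE.
by exists (enum_rank_in vA [set j | v 0 j != 0]); rewrite enum_rankK_in.
Qed.

(** * Toric rings and toric ideals *)

(* The Laurent polynomial ring K[x_1^{+-1}, ..., x_n^{+-1}, t] is viewed inside
   the field of rational functions K(x_1, ..., x_n, t); the last of the n + 1
   variables is t. *)
Definition ratfun (K : fieldType) (n : nat) : fieldType :=
  {fraction {mpoly K[n.+1]}}.

Section Toric.
Variables (K : fieldType) (n : nat).
Local Notation F := (ratfun K n).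

Definition ratfun_const (c : K) : F := tofrac (c%:MP : {mpoly K[n.+1]}).

Definition ratfun_x (i : 'I_n) : F :=
  tofrac ('X_(widen_ord (leqnSn n) i) : {mpoly K[n.+1]}).

Definition ratfun_t : F := tofrac ('X_ord_max : {mpoly K[n.+1]}).

(* X^a t *)
Definition toric_monomial (a : 'rV[int]_n) : F :=
  (\prod_(i < n) ratfun_x i ^ a 0 i) * ratfun_t.

(* The K-subalgebra generated by [S]. *)
Inductive generated_subalgebra (S : F -> Prop) : F -> Prop :=
| Gen_in f : S f -> generated_subalgebra S f
| Gen_const c : generated_subalgebra S (ratfun_const c)
| Gen_add f g : generated_subalgebra S f -> generated_subalgebra S g ->
    generated_subalgebra S (f + g)
| Gen_mul f g : generated_subalgebra S f -> generated_subalgebra S g ->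
    generated_subalgebra S (f * g).

Definition toric_ring (R : realType) (P : 'rV[R]_n -> Prop) : F -> Prop :=
  generated_subalgebra
    (fun f => exists2 a, lattice_point P a & f = toric_monomial a).

Definition toric_map (m : nat) (a : 'I_m -> 'rV[int]_n) : {mpoly K[m]} -> F :=
  mmap ratfun_const (fun i => toric_monomial (a i)).

Definition toric_ideal (m : nat) (a : 'I_m -> 'rV[int]_n)
    (f : {mpoly K[m]}) : Prop :=
  toric_map a f = 0.

End Toric.

Arguments toric_ring K {n R} P.
Arguments toric_ideal K {n m} a.

(** * Normality *)

Definition integral_over (F : fieldType) (A : F -> Prop) (z : F) : Prop :=
  exists2 p : {poly F}, p \is monic /\ (forall i, A p`_i) & root p z.

(* For a subring [A] of the field [F], hence a domain: [A] is integrally closed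
   in its field of fractions {f / g}. *)
Definition normal_domain (F : fieldType) (A : F -> Prop) : Prop :=
  forall f g : F, A f -> A g -> g != 0 ->
    integral_over A (f / g) -> A (f / g).

Definition normal_polytope (K : fieldType) (R : realType) (n : nat)
    (P : 'rV[R]_n -> Prop) : Prop :=
  normal_domain (toric_ring K P).

Arguments normal_polytope K {R n} P.

(** * Ideals and Groebner bases *)

Section Groebner.
Variables (K : fieldType) (m : nat).
Implicit Types (f g : {mpoly K[m]}) (I S : {mpoly K[m]} -> Prop).

Definition generated_ideal S f : Prop :=
  exists (k : nat) (c g : 'I_k -> {mpoly K[m]}),
    (forall i, S (g i)) /\ f = \sum_i c i * g i.

Definition quadratic_binomial f : Prop :=
  exists u v : 'X_{1..m},
    [/\ u != v, mdeg u = 2, mdeg v = 2 & f = 'X_[u] - 'X_[v]].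

Definition generated_by_quadratic_binomials I : Prop :=
  exists S, (forall g, S g -> quadratic_binomial g) /\
            (forall f, I f <-> generated_ideal S f).

Record monomial_order (le : rel 'X_{1..m}) : Prop := MonomialOrder {
  mo_anti : antisymmetric le;
  mo_trans : transitive le;
  mo_total : total le;
  mo_ge0 : forall u, le 0%MM u;
  mo_add : forall u v w, le u v -> le (u + w)%MM (v + w)%MM
}.

Definition is_initial (le : rel 'X_{1..m}) f (u : 'X_{1..m}) : Prop :=
  u \in msupp f /\ {in msupp f, forall v, le v u}.

(* The ideal generated by the initial monomials of the nonzero elements of
   [S]. *)
Definition initial_ideal (le : rel 'X_{1..m}) S : {mpoly K[m]} -> Prop :=
  generated_ideal
    (fun h => exists f u, [/\ S f, is_initial le f u & h = 'X_[u]]).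

Definition groebner_basis (le : rel 'X_{1..m}) I (G : seq {mpoly K[m]}) :
    Prop :=
  (forall g, g \in G -> I g /\ g != 0) /\
  (forall f, initial_ideal le I f <-> initial_ideal le (fun g => g \in G) f).

(* [msize g] is 1 plus the degree of [g]. *)
Definition quadratic g : bool := msize g == 3.

Definition has_quadratic_groebner_basis (le : rel 'X_{1..m}) I : Prop :=
  exists2 G, groebner_basis le I G & all quadratic G.

End Groebner.

(* Main.v *)
Require Import Defs.
From HB Require Import structures.
From mathcomp Require Import all_boot all_order all_algebra.
From mathcomp Require Import reals mpoly.
From mathcomp Require Import fraction boolp zify.

Set Implicit Arguments.
Unset Strict Implicit.
Unset Printing Implicit Defensive.

Import Order.TTheory GRing.Theory Num.Theory.

(** The stable sets of G are the empty set, the vertices and the edges of the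
    complement H, a disjoint union of two odd cycles C and D. Write t, P_x and
    E_xy for the variables of these sets; two monomials have the same image in
    the toric ring (the same weight) when their degrees agree and each vertex is
    covered equally often.
    (a) Given monomials u, v of the same weight without common variable, if P_x
    divides u then v has some E_xy and u some variable of a set S containing y;
    replacing P_x S by E_xy (S - y) in u creates a common variable, so that one
    concludes by induction on the degree. If neither has a P_x, the edges of u
    and v alternate along an odd cycle, which is impossible.
    (b) A quadratic Groebner basis would make a monomial all of whose divisors
    of degree 2 are least of their weight unique of its weight. Let P_a M be the
    least monomial covering C once and having degree (|C| + 1) / 2, so that M is a
    perfect matching of C - a, let N be the product of the other edges of C, and
    define P_b M', N' likewise for D. Then N P_b^2 M' and P_a^2 M N' have the
    same weight, while a divisor of degree 2 of N P_b^2 M' either divides P_b M'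
    or is alone of its weight, since H has no 4-cycle and no edge between C and
    D.
    (c) The square of w = x_C x_D t^((|C| + |D|) / 2) is the product of all edges,
    but w itself would be a perfect matching of H. *)

Local Open Scope ring_scope.

(** * Weights of monomials and the toric map *)

Section Weights.
Variables (n m : nat) (W : 'I_m -> {set 'I_n}).
Implicit Types (u v w : 'X_{1..m}) (S : {set 'I_n}) (j : 'I_n).

(* The last exponent is that of t. *)
Definition exponent S : 'X_{1..n.+1} :=
  (U_(ord_max) + \sum_(j in S) U_(widen_ord (leqnSn n) j))%MM.

(** Exponent vector of the image of ['X_[u]] under the toric map: on monomials, the fibres of that
    map are the classes of equal weight. *)
Definition weight u : 'X_{1..n.+1} := (\sum_i exponent (W i) *+ u i)%MM.

Definition multiplicity u j : nat := \sum_(i | j \in W i) u i.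

Lemma exponent_widen S j : exponent S (widen_ord (leqnSn n) j) = (j \in S).
Proof.
rewrite mnmDE mnm1E mnm_sumE eqE /= eq_sym ltn_eqF ?ltn_ord // add0n.
under eq_bigr do rewrite mnm1E eqE /=.
have [jS|jS] := boolP (j \in S).
  by rewrite (bigD1 j) //= eqxx big1 // => i /andP[_ /negPf]; rewrite eqE /= => ->.
by rewrite big1 // => i iS; case: (ltngtP i j) => // /val_inj eij; rewrite -eij iS in jS.
Qed.

Lemma exponent_max S : exponent S ord_max = 1.
Proof.
rewrite mnmDE mnm1E eqxx mnm_sumE big1 // => i _.
by rewrite mnm1E eqE /= ltn_eqF ?ltn_ord.
Qed.

Lemma weight_widen u j : weight u (widen_ord (leqnSn n) j) = multiplicity u j.
Proof.
rewrite mnm_sumE /multiplicity [RHS]big_mkcond; apply: eq_bigr => i _.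
by rewrite mulmnE exponent_widen; case: ifP; rewrite ?mul1n ?mul0n.
Qed.

Lemma weight_max u : weight u ord_max = mdeg u.
Proof.
by rewrite mnm_sumE mdegE; apply: eq_bigr => i _; rewrite mulmnE exponent_max mul1n.
Qed.

Lemma weightP u v :
  weight u = weight v <-> mdeg u = mdeg v /\ multiplicity u =1 multiplicity v.
Proof.
split=> [eq_uv | [eq_deg eq_mult]].
  by split=> [|j]; rewrite -?weight_max -?weight_widen eq_uv.
apply/mnmP=> k; case: (unliftP ord_max k) => [j|] ->; last by rewrite !weight_max.
have ->: lift ord_max j = widen_ord (leqnSn n) j by apply/val_inj/lift_max.
by rewrite !weight_widen.
Qed.

Lemma weightD u v : weight (u + v)%MM = (weight u + weight v)%MM.
Proof.
rewrite /weight -big_split /=; apply: eq_bigr => i _.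
by apply/mnmP=> k; rewrite !(mnmDE, mulmnE) mulnDr.
Qed.

Lemma multiplicityD u v j :
  multiplicity (u + v)%MM j = (multiplicity u j + multiplicity v j)%N.
Proof. by rewrite /multiplicity -big_split; apply: eq_bigr => i _; rewrite mnmDE. Qed.

Lemma multiplicity0 j : multiplicity 0%MM j = 0%N.
Proof. by rewrite /multiplicity big1 // => i _; rewrite mnm0E. Qed.

Lemma multiplicity_sum I (r : seq I) P (F : I -> 'X_{1..m}) j :
  multiplicity (\sum_(i <- r | P i) F i)%MM j =
  (\sum_(i <- r | P i) multiplicity (F i) j)%N.
Proof.
exact: (big_morph (multiplicity^~ j) (fun u v => multiplicityD u v j)
          (multiplicity0 j)).
Qed.

Lemma multiplicity1 i j : multiplicity U_(i)%MM j = (j \in W i).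
Proof.
rewrite /multiplicity; have [jWi|jWi] := boolP (j \in W i).
  rewrite (bigD1 i) //= mnm1E eqxx big1 // => l /andP[_ nli].
  by rewrite mnm1E eq_sym (negPf nli).
by rewrite big1 // => l jWl; rewrite mnm1E; case: eqP => // il; rewrite -il (negPf jWi) in jWl.
Qed.

Lemma multiplicity_gt0P u j :
  reflect (exists2 i, (0 < u i)%N & j \in W i) (0 < multiplicity u j)%N.
Proof.
rewrite lt0n sum_nat_eq0 negb_forall; apply: (iffP existsP) => [[i]|[i ui jWi]].
  by rewrite negb_imply -lt0n => /andP[jWi ui]; exists i.
by exists i; rewrite jWi -lt0n.
Qed.

End Weights.

HB.instance Definition _ (K : fieldType) (n : nat) :=
  GRing.RMorphism.copy (@ratfun_const K n)
    (@tofrac {mpoly K[n.+1]} \o @mpolyC n.+1 K).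

HB.instance Definition _ (K : fieldType) (n m : nat) (a : 'I_m -> 'rV[int]_n) :=
  GRing.RMorphism.copy (@toric_map K n m a)
    (mmap (@ratfun_const K n) (fun i => @toric_monomial K n (a i))).

Section ToricMap.
Variables (K : fieldType) (n m : nat) (W : 'I_m -> {set 'I_n}).
Implicit Types (p : {mpoly K[m]}) (u v w : 'X_{1..m}).

Local Notation a := (fun i => indicator (W i)).

Lemma toric_monomial_indicator (S : {set 'I_n}) :
  toric_monomial K (indicator S) = tofrac 'X_[exponent S].
Proof.
rewrite /toric_monomial mpolyXD tofracM mulrC; congr (_ * _).
rewrite -mprodXE rmorph_prod [RHS]big_mkcond /=; apply: eq_bigr => i _.
by rewrite mxE; case: (i \in S).
Qed.

Lemma toric_mapX u : toric_map a ('X_[u] : {mpoly K[m]}) = tofrac 'X_[weight W u].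
Proof.
rewrite /toric_map mmapX /mmap1 /weight.
rewrite (eq_bigr (fun i => tofrac 'X_[exponent (W i) *+ u i])) => [|i _].
  by rewrite -rmorph_prod mprodXE.
by rewrite toric_monomial_indicator -tofracXn mpolyXn.
Qed.

Lemma toric_mapE p :
  toric_map a p = tofrac (\sum_(u <- msupp p) p@_u *: 'X_[weight W u]).
Proof.
rewrite {1}[p]mpolyE !rmorph_sum; apply: eq_bigr => u _ /=.
rewrite -!mul_mpolyC !rmorphM; congr (_ * _); last exact: toric_mapX.
exact: mmapC.
Qed.

(** The coefficient of ['X_[weight W u]] in the image of [p] sums the coefficients of [p] over all
    monomials of that weight. As this sum vanishes, the nonzero coefficient at [u] cannot be alone
    in it. *)
Lemma toric_ideal_msupp p u : toric_ideal K a p -> u \in msupp p ->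
  exists v, [/\ v \in msupp p, v != u & weight W v = weight W u].
Proof.
move=> + u_p => /eqP.
rewrite toric_mapE tofrac_eq0 => /eqP/(congr1 (mcoeff (weight W u))).
rewrite mcoeff0 raddf_sum /= (bigD1_seq u) ?msupp_uniq //=.
rewrite mcoeffZ mcoeffX eqxx mulr1 => sum0.
have [/hasP[v v_p /andP[nvu /eqP wv]]|] :=
  boolP (has [pred v | (v != u) && (weight W v == weight W u)] (msupp p)).
  by exists v.
move/hasPn=> no_v; move: u_p; rewrite mcoeff_msupp => /eqP[].
rewrite -[RHS]sum0 big_seq_cond big1 ?addr0 // => v /andP[v_p nvu].
by have := no_v v v_p; rewrite /= nvu /= mcoeffZ mcoeffX => /negPf->; rewrite mulr0.
Qed.

Lemma toric_ideal_binomial u v :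
  weight W u = weight W v -> toric_ideal K a ('X_[u] - 'X_[v]).
Proof. by move=> eq_w; rewrite /toric_ideal rmorphB /= !toric_mapX eq_w subrr. Qed.

End ToricMap.

(** * Generated ideals, generators of toric ideals and toric rings *)

Section Ideals.
Variables (K : fieldType) (m : nat).
Implicit Types (f g : {mpoly K[m]}) (S : {mpoly K[m]} -> Prop).

Lemma generated_ideal0 S : generated_ideal S 0.
Proof.
by exists 0%N, (fun=> 0), (fun=> 0); split; [case | rewrite big_ord0].
Qed.

Lemma generated_ideal_in S f : S f -> generated_ideal S f.
Proof.
by move=> Sf; exists 1%N, (fun=> 1), (fun=> f); rewrite big_ord1 mul1r.
Qed.

Lemma generated_idealD S f g :
  generated_ideal S f -> generated_ideal S g -> generated_ideal S (f + g).
Proof.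
move=> [k [c [x [Sx ->]]]] [l [d [y [Sy ->]]]].
exists (k + l)%N, (fun i => match split i with inl i => c i | inr i => d i end),
  (fun i => match split i with inl i => x i | inr i => y i end).
split=> [i|]; first by case: split.
rewrite big_split_ord /=; congr (_ + _); apply: eq_bigr => i _.
  by rewrite -/(unsplit (inl i)) unsplitK.
by rewrite -/(unsplit (inr i)) unsplitK.
Qed.

Lemma generated_idealM S f g :
  generated_ideal S g -> generated_ideal S (f * g).
Proof.
move=> [k [c [x [Sx ->]]]]; exists k, (fun i => f * c i), x; split=> //.
by rewrite mulr_sumr; apply: eq_bigr => i _; rewrite mulrA.
Qed.

End Ideals.

Section ToricGenerators.
Variables (K : fieldType) (n m : nat) (W : 'I_m -> {set 'I_n}).

Local Notation a := (fun i => indicator (W i)).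

(** Reduces generation to binomials, by induction on the size of the support: if [u] and [v] are
    monomials of [f] of the same weight, subtracting a multiple of ['X_[u] - 'X_[v]] removes [u]
    from the support and adds nothing, since [v] was there already. *)
Lemma toric_ideal_generated (S : {mpoly K[m]} -> Prop) :
  (forall g, S g -> toric_ideal K a g) ->
  (forall u v, weight W u = weight W v -> generated_ideal S ('X_[u] - 'X_[v])) ->
  forall f, toric_ideal K a f <-> generated_ideal S f.
Proof.
move=> SI gen f; split; last first.
  move=> [k [c [x [Sx ->]]]]; rewrite /toric_ideal rmorph_sum big1 //= => i _.
  by rewrite rmorphM /= [X in _ * X]SI ?mulr0.
have [k] := ubnP (size (msupp f)); elim: k f => // k IHk f; rewrite ltnS => le_f_k If.
case def_u: (msupp f) => [|u s].
  by move/eqP: def_u; rewrite msupp_eq0 => /eqP->; apply: generated_ideal0.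
have u_f: u \in msupp f by rewrite def_u mem_head.
have [v [v_f nvu eq_w]] := toric_ideal_msupp If u_f.
pose h : {mpoly K[m]} := 'X_[u] - 'X_[v].
have Gh : generated_ideal S ((f@_u)%:MP * h).
  by apply/generated_idealM/gen.
rewrite -[f](subrK ((f@_u)%:MP * h)); apply: generated_idealD => //; apply: IHk.
  apply: leq_trans le_f_k; rewrite def_u ltnS.
  apply: uniq_leq_size => [|w]; first exact: msupp_uniq.
  rewrite !mcoeff_msupp mcoeffB mcoeffCM mcoeffB !mcoeffX => w_nz.
  have nwu : w != u.
    by apply: contraNneq w_nz => ->; rewrite eqxx (negPf nvu) subr0 mulr1 subrr.
  suff: w \in msupp f by rewrite def_u => /predU1P[wu|//]; case/eqP: nwu.
  rewrite mcoeff_msupp; apply: contraNneq w_nz => fw0.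
  have nvw : v != w by apply: contraTneq v_f => ->; rewrite mcoeff_msupp fw0 eqxx.
  by rewrite fw0 [u == w]eq_sym (negPf nwu) (negPf nvw) subrr mulr0 subr0.
rewrite /toric_ideal rmorphB rmorphM /= (toric_ideal_binomial _ (esym eq_w)).
by rewrite mulr0 subr0.
Qed.

(** Replaces membership in the inductively generated subalgebra by a polynomial preimage, whose
    support can then be inspected. *)
Lemma toric_ring_map (R : realType) (P : 'rV[R]_n -> Prop) (f : ratfun K n) :
  (forall v, lattice_point P v <-> exists i, v = a i) ->
  toric_ring K P f <-> exists p, f = toric_map a p.
Proof.
move=> latP; split=> [|[p ->]].
  elim=> {f} [f [v /latP[i ->] ->]|c|f g _ [p ->] _ [q ->]|f g _ [p ->] _ [q ->]].
  - by exists 'X_i; rewrite /toric_map mmapX mmap1U.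
  - by exists c%:MP; rewrite /toric_map mmapC.
  - by exists (p + q); rewrite rmorphD.
  - by exists (p * q); rewrite rmorphM.
have gen0 : toric_ring K P 0 by rewrite -[0](rmorph0 (@ratfun_const K n)); apply: Gen_const.
have gen1 : toric_ring K P 1 by rewrite -[1](rmorph1 (@ratfun_const K n)); apply: Gen_const.
rewrite /toric_map /mmap; apply: big_ind => [//|x y|u _]; first exact: Gen_add.
apply: Gen_mul; first exact: Gen_const.
rewrite /mmap1; apply: big_ind => [//|x y|i _]; first exact: Gen_mul.
elim: (u i) => [//|d IHd]; rewrite exprS; apply: Gen_mul => //.
by apply: Gen_in; exists (a i) => //; apply/latP; exists i.
Qed.

End ToricGenerators.

(** * Lattice points of the stable set polytope *)

Section StableSetPolytope.
Variables (R : realType) (n : nat) (e : rel 'I_n).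
Implicit Types (S : {set 'I_n}).

Lemma rhoE S j : rho R S 0 j = (j \in S)%:R.
Proof.
rewrite /rho summxE; have [jS|jS] := boolP (j \in S).
  rewrite (bigD1 j) //= mxE !eqxx big1 ?addr0 // => l /andP[_ /negPf nlj].
  by rewrite mxE eq_sym nlj andbF.
by rewrite big1 // => l lS; rewrite mxE /=; case: eqP => // jl; rewrite jl lS in jS.
Qed.

(** A vertex with positive coefficient in the convex combination is the lattice point itself: an
    integral coordinate in [0, 1] is 1 if that vertex makes it positive, and 0 if that vertex keeps
    it below 1. *)
Lemma stable_set_polytope_lattice (v : 'rV[int]_n) :
  lattice_point (stable_set_polytope R e) v <->
  exists2 S, stable e S & v = indicator S.
Proof.
split=> [|[S stS ->]]; last first.
  exists 1%N, (fun=> rho R S), (fun=> 1); split=> //; first by exists S.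
  - by rewrite big_ord1.
  - by rewrite big_ord1 scale1r; apply/rowP=> j; rewrite rhoE !mxE; case: (j \in S).
move=> [k [x [c [Sx c_ge0 c_sum vE]]]].
have [i ci_gt0] : exists i, 0 < c i.
  case: (pickP (fun i => 0 < c i)) => [i ci|c_le0]; first by exists i.
  move: c_sum; rewrite big1 => [/eqP|i _]; first by rewrite eq_sym oner_eq0.
  by apply/eqP; rewrite eq_le c_ge0 andbT leNgt c_le0.
have [S stS xiE] := Sx i; exists S => //; apply/rowP=> j.
have x01 l : 0 <= x l 0 j <= 1.
  by have [S' _ ->] := Sx l; rewrite rhoE; case: (j \in S'); rewrite ?lexx ?ler01.
have vj : (v 0 j)%:~R = \sum_l c l * x l 0 j.
  by move/rowP/(_ j): vE; rewrite mxE summxE => ->; apply: eq_bigr => l _; rewrite mxE.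
have cx_ge0 l : 0 <= c l * x l 0 j by rewrite mulr_ge0 //; case/andP: (x01 l).
have cx_le l : c l * x l 0 j <= c l by rewrite ler_piMr //; case/andP: (x01 l).
have v_ge0 : 0 <= v 0 j by rewrite -(ler0z R) vj sumr_ge0.
have v_le1 : v 0 j <= 1 by rewrite -(ler_int R) vj -c_sum ler_sum.
rewrite mxE; case: (boolP (j \in S)) => jS.
  apply/eqP; rewrite eq_le v_le1 /= -gtz0_ge1 -(ltr0z R) vj (bigD1 i) //=.
  by rewrite ltr_pwDl ?sumr_ge0 // xiE rhoE jS mulr1.
apply/eqP; rewrite eq_le v_ge0 andbT -ltzD1 add0r -(ltr_int R) vj -c_sum.
rewrite (bigD1 i) //= [X in _ < X](bigD1 i) //=.
by rewrite ltr_leD ?ler_sum // xiE rhoE (negPf jS) mulr0.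
Qed.

(** Allows the variables to be indexed by the stable sets [W i] instead of lattice points, so that
    only combinatorics of sets remains. *)
Lemma stable_set_polytope_enum_stable m (a : 'I_m -> 'rV[int]_n) :
  lattice_enum (stable_set_polytope R e) a ->
  exists W : 'I_m -> {set 'I_n},
    [/\ a = (fun i => indicator (W i)), injective W
      & forall S, stable e S <-> exists i, W i = S].
Proof.
move=> [a_inj latP].
have a_ex i : exists S, stable e S /\ a i = indicator S.
  have /stable_set_polytope_lattice[S stS aS] : lattice_point (stable_set_polytope R e) (a i).
    by apply/latP; exists i.
  by exists S.
have [W WP] := choice a_ex; exists W; split.
- by apply/funext => i; case: (WP i).
- by move=> i j eqW; apply: a_inj; rewrite (WP i).2 (WP j).2 eqW.
move=> S; split=> [stS|[i <-]]; last by case: (WP i).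
have /latP[i ai] : lattice_point (stable_set_polytope R e) (indicator S).
  by apply/stable_set_polytope_lattice; exists S.
exists i; apply/setP=> j; have [_ aW] := WP i; move: ai; rewrite aW.
by move/rowP/(_ j); rewrite !mxE; do 2!case: (_ \in _).
Qed.

End StableSetPolytope.

(** * Disjoint odd cycles *)

Section OddCycles.
Variable T : finType.
Implicit Types (h : rel T) (f : T -> T).

(** A disjoint union of cycles is encoded by its successor permutation [f]: the cycles are the
    orbits, and the edges join each vertex to its image. *)
Definition odd_cycles h f : Prop :=
  [/\ injective f, forall x y, h x y = (f x == y) || (f y == x),
      forall x, odd (order f x) & forall x, (4 < order f x)%N].

(** The permutation follows [next s] on one hole and [next t] on the other. It describes every edge
    because the holes are induced, cover all vertices and have no edge between them; [x] and [y] are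
    taken one in each. *)
Lemma two_disjoint_odd_holes_cycles h : two_disjoint_odd_holes h ->
  exists f x y, odd_cycles h f /\ ~~ fconnect f x y.
Proof.
move=> [C [D [[[s [Us s_gt3 Cs hs]] oddC] [[t [Ut t_gt3 Dt ht]] oddD] CD0 CDT hCD]]].
have CE x : (x \in C) = (x \in s) by rewrite Cs inE.
have DE x : (x \in D) = (x \in t) by rewrite Dt inE.
have sizeE (r : seq T) : uniq r -> #|[set x in r]| = size r.
  by move=> Ur; rewrite cardsE; apply/card_uniqP.
have tE x : (x \in t) = (x \notin s).
  have := in_setT x; rewrite -CDT inE CE DE; case: (boolP (x \in s)) => //= xs _.
  by apply/negP=> xt; move/pred0P/(_ x): CD0; rewrite /= CE DE xs xt.
pose f x := if x \in s then next s x else next t x.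
have f_s x : x \in s -> f x = next s x by rewrite /f => ->.
have f_t x : x \in t -> f x = next t x by rewrite /f tE => /negPf->.
have fin_s x : (f x \in s) = (x \in s).
  rewrite /f; case: (boolP (x \in s)) => xs; first by rewrite mem_next.
  by apply/negbTE; rewrite -tE mem_next tE.
have cyc_s : fcycle f s by apply: cycle_from_next => // x xs; rewrite /= f_s.
have cyc_t : fcycle f t by apply: cycle_from_next => // x xt; rewrite /= f_t.
have ordf x : odd (order f x) && (3 < order f x)%N.
  case: (boolP (x \in s)) => xs; first by rewrite (order_cycle cyc_s) // -{1}sizeE // -Cs oddC.
  by rewrite (order_cycle cyc_t) ?tE // -{1}sizeE // -Dt oddD.
have f_inj : injective f.
  move=> x y eq_f; have := fin_s x; rewrite eq_f fin_s => eq_s; move: eq_f.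
  by rewrite /f eq_s; case: (x \in s) => /(can_inj (prev_next _)); apply.
have f_neq x y : x \in s -> y \in t -> (f x == y) || (f y == x) = false.
  move=> xs yt; apply/negP=> /orP[] /eqP eq_f.
    by move: yt; rewrite tE -eq_f fin_s xs.
  by move: xs; apply/negP; rewrite -tE -eq_f tE fin_s -tE.
have [x xs] : exists x, x \in s by case: (s) s_gt3 => // x s' _; exists x; apply: mem_head.
have [y yt] : exists y, y \in t by case: (t) t_gt3 => // y t' _; exists y; apply: mem_head.
exists f, x, y; split; last by rewrite (fconnect_cycle cyc_s xs) -tE.
split=> // [u v|u|u].
- case: (boolP (u \in s)) => us; case: (boolP (v \in s)) => vs.
  + by rewrite hs ?f_s.
  + rewrite f_neq ?tE //.
    have uC : u \in C by rewrite CE.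
    have vD : v \in D by rewrite DE tE.
    by apply/negbTE; case/andP: (hCD u v uC vD).
  + rewrite orbC f_neq ?tE //.
    have vC : v \in C by rewrite CE.
    have uD : u \in D by rewrite DE tE.
    by apply/negbTE; case/andP: (hCD v u vC uD).
  + by rewrite ht ?f_t ?tE.
- by case/andP: (ordf u).
(* A hole has length at least 4, and an odd one cannot have length 4. *)
- have /andP[odd_u] := ordf u; rewrite leq_eqVlt => /predU1P[u4|//].
  by rewrite -u4 in odd_u.
Qed.

Section Cycles.
Variables (h : rel T) (f : T -> T).
Hypothesis hf : odd_cycles h f.

Lemma iter_cycle_neq x k : (0 < k <= 4)%N -> iter k f x != x.
Proof.
case: hf => _ _ _ order_gt4 /andP[k_gt0 k_le4].
have k_lt : (k < order f x)%N by apply: leq_ltn_trans (order_gt4 x).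
apply/eqP=> fkx; have := findex_iter k_lt; rewrite fkx findex0 => k0.
by rewrite -k0 in k_gt0.
Qed.

Lemma cycle_rel_next x : h x (f x).
Proof. by case: hf => _ -> _ _; rewrite eqxx. Qed.

Lemma cycle_rel_sym x y : h x y = h y x.
Proof. by case: hf => _ hE _ _; rewrite !hE orbC. Qed.

Lemma cycle_rel_connect x y : h x y -> fconnect f x y.
Proof.
case: hf => f_inj -> _ _ /orP[] /eqP <-; first exact: fconnect1.
by rewrite fconnect_sym // fconnect1.
Qed.

(** By symmetry the first edge may be directed forward along [f]; then each choice of directions for
    the other two makes [f] or its third iterate fix a vertex. *)
Lemma no_triangle x y z : h x y -> h y z -> h z x -> False.
Proof.
have step a b c : f a = b -> h b c -> h c a -> False.
  case: hf => f_inj hE _ _ <-; rewrite !hE => /orP[] /eqP.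
    move=> <- /orP[] /eqP; first by apply/eqP/(iter_cycle_neq a (k := 3)).
    by move/f_inj/eqP; rewrite eq_sym; apply/negP/(iter_cycle_neq a (k := 1)).
  by move/f_inj=> -> /orP[] /eqP/eqP; apply/negP/(iter_cycle_neq a (k := 1)).
case: (hf) => _ hE _ _; rewrite {1}hE => /orP[] /eqP; first exact: step.
by move=> fyx hyz hzx; apply: (step _ _ z fyx); rewrite cycle_rel_sym.
Qed.

(** Opposite vertices being distinct, the walk never turns back, so that all four edges run the same
    way and the fourth iterate of [f] fixes a vertex. *)
Lemma no_square x y z t :
  h x y -> h y z -> h z t -> h t x -> x != z -> y != t -> False.
Proof.
have step a b c d :
    f a = b -> h b c -> h c d -> h d a -> a != c -> b != d -> False.
  case: hf => f_inj hE _ _ <-; rewrite !hE => hbc hcd hda nac nbd.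
  case/orP: hbc => [/eqP fbc|]; last by rewrite (inj_eq f_inj) eq_sym (negPf nac).
  case/orP: hda => [/eqP fda|]; last by rewrite (negPf nbd).
  case/orP: hcd => /eqP fcd; last by rewrite -fcd fda eqxx in nac.
  by have := iter_cycle_neq a (k := 4) isT; rewrite /= fbc fcd fda eqxx.
case: (hf) => _ hE _ _; rewrite {1}hE => /orP[] /eqP; first exact: step.
move=> fyx hyz hzt htx nxz nyt.
by apply: (step _ _ t z fyx); rewrite 1?cycle_rel_sym.
Qed.

End Cycles.
End OddCycles.

(** * Stable sets when the complement is a union of odd cycles *)

Section StableSets.
Variables (n : nat) (e : rel 'I_n) (f : 'I_n -> 'I_n).
Hypothesis hf : odd_cycles (complement e) f.
Implicit Types (S : {set 'I_n}).

Lemma stable_complementP S :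
  reflect {in S &, forall x y, x != y -> complement e x y} (stable e S).
Proof.
apply: (iffP forall_inP) => [stS x y xS yS nxy | stS x xS].
  by rewrite /complement nxy; have /forall_inP/(_ y yS) := stS x xS; rewrite nxy.
by apply/forall_inP=> y yS; apply/implyP => nxy; have /andP[] := stS x y xS yS nxy.
Qed.

Lemma stable_sub S S' : S' \subset S -> stable e S -> stable e S'.
Proof.
move=> /subsetP sS /stable_complementP stS; apply/stable_complementP=> x y /sS xS /sS yS.
exact: stS.
Qed.

Lemma stable_pair x y : complement e x y -> stable e [set x; y].
Proof.
move=> hxy; apply/stable_complementP=> u v /set2P[] -> /set2P[] ->; rewrite ?eqxx //.
by rewrite (cycle_rel_sym hf).
Qed.

Lemma stable_set2 (x : 'I_n) : stable e [set x; f x].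
Proof. exact/stable_pair/(cycle_rel_next hf). Qed.

Lemma stable_set1 x : stable e [set x].
Proof. by apply: stable_sub (stable_set2 x); rewrite sub1set set21. Qed.

Lemma stable_set0 : stable e set0.
Proof. by apply/stable_complementP=> x y; rewrite inE. Qed.

Lemma stable_card_le2 S : stable e S -> (#|S| <= 2)%N.
Proof.
move=> /stable_complementP stS; rewrite leqNgt; apply/negP=> /card_gt2P.
move=> [x [y [z [[xS yS zS] [nxy nyz nzx]]]]].
by apply: (no_triangle hf (x := x) (y := y) (z := z)); apply: stS.
Qed.

Lemma stable_card2 S : stable e S -> #|S| = 2%N -> exists x, S = [set x; f x].
Proof.
move=> /stable_complementP stS /eqP/cards2P[x [y [nxy SE]]].
case: (hf) => _ hE _ _; have := stS x y; rewrite {}SE set21 set22 hE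
  => /(_ isT isT nxy) xy; move: xy.
by case/orP=> /eqP <-; [exists x | exists y; rewrite setUC].
Qed.

Lemma card_set2_next (x : 'I_n) : #|[set x; f x]| = 2%N.
Proof. by rewrite cards2 eq_sym (iter_cycle_neq hf x (k := 1)). Qed.

(** The vertex [x] provides an edge of the complement, hence a stable set of size 2. *)
Lemma independence_number_cycles (x : 'I_n) : independence_number e = 2%N.
Proof.
apply/eqP; rewrite eqn_leq; apply/andP; split.
  by apply/bigmax_leqP => S; apply: stable_card_le2.
by rewrite -(card_set2_next x); apply: (@leq_bigmax_cond _ (stable e)); apply: stable_set2.
Qed.

(** * Quadratic generation *)

Section Fibers.
Variables (K : fieldType) (m : nat) (W : 'I_m -> {set 'I_n}).
Hypotheses (W_inj : injective W) (stW : forall S, stable e S <-> exists i, W i = S).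
Implicit Types (u v w r : 'X_{1..m}).

Local Notation a := (fun i => indicator (W i)).

Lemma W_stable i : stable e (W i).
Proof. by apply/stW; exists i. Qed.

Lemma U_addK u i : (0 < u i)%N -> (u - U_(i) + U_(i))%MM = u.
Proof. by move=> ui; rewrite submK // lep1mP -lt0n. Qed.

Definition quadratic_relation (g : {mpoly K[m]}) : Prop :=
  quadratic_binomial g /\ toric_ideal K a g.

Local Notation J := (generated_ideal quadratic_relation).

Lemma exchange i j k l r : weight W (U_(i) + U_(j))%MM = weight W (U_(k) + U_(l))%MM ->
  J ('X_[U_(i) + U_(j) + r] - 'X_[U_(k) + U_(l) + r]).
Proof.
move=> eq_w; rewrite !['X_[_ + r]]mpolyXD -mulrBl mulrC; apply: generated_idealM.
(* A quadratic binomial has two distinct monomials, so the trivial exchange is treated apart. *)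
have [->|neq] := eqVneq (U_(i) + U_(j))%MM (U_(k) + U_(l))%MM.
  by rewrite subrr; apply: generated_ideal0.
apply: generated_ideal_in; split; last exact: toric_ideal_binomial.
by exists (U_(i) + U_(j))%MM, (U_(k) + U_(l))%MM; rewrite !mdegD !mdeg1.
Qed.

Lemma multiplicity_pos u v x i :
  multiplicity W u =1 multiplicity W v -> (0 < u i)%N -> x \in W i ->
  exists2 j, (0 < v j)%N & x \in W j.
Proof.
move=> eq_m ui xi; apply/multiplicity_gt0P; rewrite -eq_m.
by apply/multiplicity_gt0P; exists i.
Qed.

(** Since [v] lacks P_x, it covers [x] by an edge [W j] = {x, y}, and [u] covers [y] by some [W k].
    Moving [y] from [W k] to the singleton is a quadratic exchange, and it creates the variable [j],
    which divides [v]. *)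
Lemma exchange_singleton u v i x :
  weight W u = weight W v -> (0 < u i)%N -> W i = [set x] -> v i = 0%N ->
  (forall l, (0 < u l)%N -> (0 < v l)%N -> False) ->
  exists2 u', weight W u' = weight W u /\ J ('X_[u] - 'X_[u'])
            & exists2 l, (0 < u' l)%N & (0 < v l)%N.
Proof.
move=> eq_w ui Wi vi0 no_common; have [_ eq_m] := (weightP W u v).1 eq_w.
have xi : x \in W i by rewrite Wi set11.
have [j vj xj] := multiplicity_pos eq_m ui xi.
have [y yj nyx] : exists2 y, y \in W j & y != x.
  apply/exists_inP; apply: contraT; rewrite negb_exists_in => /forall_inP all_x.
  suff Wj : W j = W i by move: vj; rewrite (W_inj Wj) vi0.
  rewrite Wi; apply/eqP; rewrite eqEsubset sub1set xj andbT.
  by apply/subsetP=> z /all_x; rewrite negbK inE.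
have [k uk yk] := multiplicity_pos (fun z => esym (eq_m z)) vj yj.
have nik : k != i by apply: contraNneq nyx => ki; move: yk; rewrite ki Wi inE.
have Wj : W j = [set x; y].
  apply/esym/eqP; rewrite eqEcard subUset !sub1set xj yj cards2 eq_sym nyx.
  exact/stable_card_le2/W_stable.
have xk : x \notin W k.
  (* If it contained [x] as well as [y], [W k] would be the edge [W j], and [u] and [v] would share
     a variable. *)
  apply/negP=> xk; suff jk : j = k by apply: (no_common k); rewrite // -jk.
  apply: W_inj; apply/eqP; rewrite Wj eqEcard subUset !sub1set xk yk cards2 eq_sym nyx.
  exact/stable_card_le2/W_stable.
have /stW[l Wl] : stable e (W k :\ y) by apply: stable_sub (W_stable k); apply: subD1set.
have eq_ex : weight W (U_(i) + U_(k))%MM = weight W (U_(j) + U_(l))%MM.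
  apply/weightP; split=> [|z]; first by rewrite !mdegD !mdeg1.
  rewrite !multiplicityD !multiplicity1 Wi Wj Wl !inE.
  have [->|nzx] := eqVneq z x; first by rewrite (negPf xk) andbF.
  by have [->|nzy] := eqVneq z y; rewrite ?yk.
pose r := (u - (U_(i) + U_(k)))%MM.
have uE : u = (U_(i) + U_(k) + r)%MM.
  rewrite addmC submK //; apply/mnm_lepP=> z; rewrite mnmDE !mnm1E.
  by have [<-|] := eqVneq i z; [rewrite (negPf nik) | have [<-|_] := eqVneq k z].
exists (U_(j) + U_(l) + r)%MM; last first.
  by exists j; rewrite // !mnmDE mnm1E eqxx.
split; last by rewrite {1}uE; apply: exchange.
by rewrite [in RHS]uE weightD -eq_ex -weightD.
Qed.

(** In [v] the vertex [f x] is covered by an edge, which is one of the two edges at [f x]; the edge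
    {x, f x} is excluded because it divides [u]. *)
Lemma alternate_edges u v x i :
  weight W u = weight W v -> (0 < u i)%N -> W i = [set x; f x] ->
  (forall l, (0 < u l)%N -> (0 < v l)%N -> False) ->
  (forall l, (0 < v l)%N -> #|W l| != 1%N) ->
  exists2 l, (0 < v l)%N & W l = [set f x; f (f x)].
Proof.
move=> eq_w ui Wi no_common no_single; have [_ eq_m] := (weightP W u v).1 eq_w.
have xi : f x \in W i by rewrite Wi set22.
have [j vj xj] := multiplicity_pos eq_m ui xi; exists j => //.
have /(stable_card2 (W_stable j))[y Wj] : #|W j| = 2%N.
  apply/eqP; rewrite eqn_leq stable_card_le2 ?W_stable //= ltn_neqAle eq_sym no_single //.
  by apply/card_gt0P; exists (f x).
move: xj; rewrite Wj => /set2P[<- //|]; case: hf => f_inj _ _ _ /f_inj xy.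
have ij : i = j by apply: W_inj; rewrite Wi Wj xy.
by case: (no_common i) => //; rewrite ij.
Qed.

Lemma binomial_generated u v : weight W u = weight W v -> J ('X_[u] - 'X_[v]).
Proof.
have [d] := ubnP (mdeg u); elim: d => // d IHd in u v *; rewrite ltnS => le_ud eq_w.
have cancel_common u' v' l : (mdeg u' <= d)%N -> weight W u' = weight W v' ->
    (0 < u' l)%N -> (0 < v' l)%N -> J ('X_[u'] - 'X_[v']).
  move=> le_d eq_w' u'l v'l; rewrite -(U_addK u'l) -(U_addK v'l) !mpolyXD -mulrBl mulrC.
  apply/generated_idealM/IHd; last first.
    by apply: (@addIm _ (weight W U_(l))); rewrite -!weightD !U_addK.
  by apply: leq_trans le_d; rewrite -[in ltnRHS](U_addK u'l) mdegD mdeg1 addn1.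
have [eq_d _] := (weightP W u v).1 eq_w.
case: (pickP (fun l => (0 < u l) && (0 < v l))%N) => [l /andP[ul vl]|no_common].
  exact: cancel_common ul vl.
have no_uv l : (0 < u l)%N -> (0 < v l)%N -> False.
  by move=> ul vl; have := no_common l; rewrite ul vl.
have no_vu l : (0 < v l)%N -> (0 < u l)%N -> False by move=> vl ul; apply: (no_uv l).
(* Stated for arbitrary monomials, so as to serve also with [u] and [v] interchanged. *)
have single u' v' i : (mdeg u' <= d)%N -> weight W u' = weight W v' ->
    (forall l, (0 < u' l)%N -> (0 < v' l)%N -> False) ->
    (0 < u' i)%N -> #|W i| = 1%N -> J ('X_[u'] - 'X_[v']).
  move=> le_d eq_w' no_common' u'i /eqP/cards1P[x Wi].
  have v'i : v' i = 0%N by apply/eqP; rewrite -leqn0 leqNgt; apply/negP/no_common'.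
  have [u'' [eq_w'' Ju''] [l u''l v'l]] := exchange_singleton eq_w' u'i Wi v'i no_common'.
  rewrite -(subrKA 'X_[u'']); apply: generated_idealD => //.
  apply: cancel_common u''l v'l; last by rewrite eq_w''.
  by have [-> _] := (weightP W u'' u').1 eq_w''.
case: (pickP (fun i => (0 < u i)%N && (#|W i| == 1%N))) => [i /andP[ui /eqP]|no_u].
  exact: single.
case: (pickP (fun i => (0 < v i)%N && (#|W i| == 1%N))) => [i /andP[vi /eqP Wi]|no_v].
  rewrite -opprB -mulN1r; apply/generated_idealM/(single v u i) => //.
  by rewrite -eq_d.
have u2 l : (0 < u l)%N -> #|W l| != 1%N by move=> ul; have := no_u l; rewrite ul => /negbT.
have v2 l : (0 < v l)%N -> #|W l| != 1%N by move=> vl; have := no_v l; rewrite vl => /negbT.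
have no_edge i : (0 < u i)%N -> W i = set0.
  move=> ui; apply/eqP; rewrite -cards_eq0 -leqn0 leqNgt; apply/negP => Wi_gt0.
  have /(stable_card2 (W_stable i))[x Wi] : #|W i| = 2%N.
    by apply/eqP; rewrite eqn_leq stable_card_le2 ?W_stable //= ltn_neqAle eq_sym u2.
  (* Following the cycle from the edge {x, f x} of [u], the edges lie in [u] and [v] by turns. After
     an odd number of steps, the length of the cycle, the same edge reappears in [v]. *)
  have alt k : exists2 l, (0 < (if odd k then v else u) l)%N
                        & W l = [set iter k f x; iter k.+1 f x].
    elim: k => [|k [l]]; first by exists i.
    rewrite /=; case: (odd k) => /= wl Wl.
      exact: (alternate_edges (esym eq_w) wl Wl).
    exact: (alternate_edges eq_w wl Wl).
  have [f_inj _ odd_f _] := hf; have [l] := alt (order f x).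
  rewrite odd_f iterS iter_order // -Wi => vl /W_inj li.
  by apply: (no_uv i); rewrite // -li.
have pos w : mdeg w != 0%N -> exists i, (0 < w i)%N.
  rewrite mdegE sum_nat_eq0 negb_forall => /existsP[i]; rewrite negb_imply -lt0n.
  by exists i.
have [u0|u_nz] := eqVneq (mdeg u) 0%N.
  have /eqP-> : u == 0%MM by rewrite -mdeg_eq0 u0.
  have /eqP-> : v == 0%MM by rewrite -mdeg_eq0 -eq_d u0.
  by rewrite subrr; apply: generated_ideal0.
(* Only the empty set is left in [u], hence in [v] too, so that both contain its variable. *)
have [i ui] := pos u u_nz; have [j vj] : exists j, (0 < v j)%N by apply: pos; rewrite -eq_d.
case: (no_uv j) => //; suff <- : i = j by [].
apply: W_inj; rewrite no_edge //; apply/esym/eqP; rewrite -subset0; apply/subsetP=> x xj.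
have [_ eq_m] := (weightP W u v).1 eq_w.
have [k uk] := multiplicity_pos (fun z => esym (eq_m z)) vj xj.
by rewrite no_edge.
Qed.

End Fibers.
End StableSets.

(** * Non-normality *)

Lemma integral_sqrt (F : fieldType) (A : F -> Prop) (x y c : F) :
  A 0 -> A 1 -> A (- c) -> y != 0 -> x ^+ 2 = y ^+ 2 * c -> integral_over A (x / y).
Proof.
move=> A0 A1 Ac y_nz x2; exists ('X^2 - c%:P).
  split=> [|i]; first exact: monicXnsubC.
  by rewrite coefB coefXn coefC; case: i => [|[|[|i]]] /=; rewrite ?mulr0n ?sub0r ?subr0 ?oppr0.
rewrite rootE hornerD hornerN hornerXn hornerC expr_div_n x2 mulrAC.
by rewrite mulfV ?expf_neq0 // mul1r subrr.
Qed.

Section Normality.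
Variables (n : nat) (e : rel 'I_n) (f : 'I_n -> 'I_n).
Hypothesis hf : odd_cycles (complement e) f.
Variables (m : nat) (W : 'I_m -> {set 'I_n}).
Hypothesis (stW : forall S, stable e S <-> exists i, W i = S).
Implicit Types (A : {set 'I_n}) (u v w : 'X_{1..m}).

Lemma sum_multiplicity u A :
  (\sum_(j in A) multiplicity W u j = \sum_i u i * #|W i :&: A|)%N.
Proof.
rewrite /multiplicity (exchange_big_dep xpredT) //=; apply: eq_bigr => i _.
rewrite sum_nat_const mulnC; congr (_ * _)%N; apply: eq_card => j.
by rewrite !inE andbC.
Qed.

Lemma sum_eq_mem A j : (\sum_(z in A) (j == z) = (j \in A))%N.
Proof.
have [jA|jA] := boolP (j \in A).
  by rewrite (bigD1 j) //= eqxx big1 // => z /andP[_]; rewrite eq_sym => /negPf->.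
by rewrite big1 // => z zA; case: eqP => // jz; rewrite jz zA in jA.
Qed.

(** The vertex [j] lies on exactly two of the edges {z, f z}, those with [z] equal to [j] and to
    [finv f j]; both indices belong to [A] as soon as [j] does. *)
Lemma multiplicity_edges A (iE : 'I_n -> 'I_m) j :
  (forall z, W (iE z) = [set z; f z]) -> (forall z, (f z \in A) = (z \in A)) ->
  multiplicity W (\sum_(z in A) U_(iE z))%MM j = (j \in A).*2.
Proof.
move=> WE A_f; have [f_inj _ _ _] := hf.
have fA : (finv f j \in A) = (j \in A) by rewrite -[LHS]A_f (f_finv f_inj).
rewrite multiplicity_sum -addnn -{2}fA -!sum_eq_mem -big_split /=.
apply: eq_bigr => z _; rewrite multiplicity1 WE !inE.
have -> : (j == f z) = (finv f j == z) by rewrite -{1}(f_finv f_inj j) (inj_eq f_inj).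
have [->|//] := eqVneq j z; rewrite -[finv f z == z](inj_eq f_inj) (f_finv f_inj) eq_sym.
by rewrite (negPf (iter_cycle_neq hf z (k := 1) isT)).
Qed.

(* A perfect matching would match the vertices of the cycle of x in pairs. *)
Lemma no_perfect_matching u A x :
  (forall j, multiplicity W u j = (j \in A)) -> (mdeg u).*2 = #|A| ->
  {subset fconnect f x <= A} -> False.
Proof.
move=> mult_u deg_u CA; have sumA (S : {set 'I_n}) : S \subset A ->
    (\sum_i u i * #|W i :&: S| = #|S|)%N.
  move=> /subsetP sSA; rewrite -sum_multiplicity -sum1_card; apply: eq_bigr => j jS.
  by rewrite mult_u sSA.
have WiA i : (0 < u i)%N -> W i \subset A.
  move=> ui; apply/subsetP=> j jWi; have : (0 < multiplicity W u j)%N.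
    by apply/multiplicity_gt0P; exists i.
  by rewrite mult_u lt0b.
(* The degree is just large enough to cover [A] by sets of size 2, so a smaller set would leave too
   little in total. *)
have card2 i : (0 < u i)%N -> #|W i| = 2%N.
  move=> ui; apply/eqP; rewrite eqn_leq (stable_card_le2 hf (W_stable stW i)) /= leqNgt.
  apply/negP=> Wi_lt2; suff: (\sum_l u l * #|W l :&: A| < (mdeg u).*2)%N.
    by rewrite sumA // deg_u ltnn.
  rewrite mdegE -muln2 big_distrl /= (bigD1 i) //= [ltnRHS](bigD1 i) //=.
  rewrite -addSn; apply: leq_add.
    by rewrite ltn_pmul2l // (setIidPl (WiA i ui)).
  apply: leq_sum => l _; rewrite leq_mul2l; apply/orP; right.
  apply: leq_trans (stable_card_le2 hf (W_stable stW l)).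
  by apply/subset_leq_card/subsetIl.
pose C := [set z | fconnect f x z].
have [f_inj _ odd_f _] := hf.
have odd_C : odd #|C| by rewrite cardsE -/(order f x).
move: odd_C; rewrite -(sumA C); last by apply/subsetP=> z; rewrite inE => /CA.
(* Each edge meets the cycle [C] in 2 vertices or in none, which would make the odd number [#|C|]
   even. *)
apply/negP; rewrite -dvdn2; apply: dvdn_sum => i _.
have [->//|] := posnP (u i) => ui; apply: dvdn_mull.
have [z Wi] := stable_card2 hf (W_stable stW i) (card2 i ui).
have zfz : fconnect f x (f z) = fconnect f x z.
  by rewrite -(same_fconnect1_r f_inj).
have [xz|xz] := boolP (fconnect f x z).
  by rewrite (setIidPl _) ?card2 // Wi subUset !sub1set !inE zfz xz.
rewrite (_ : _ :&: _ = set0) ?cards0 //; apply/setP=> j; rewrite Wi !inE.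
by apply/negP=> /andP[/orP[] /eqP->]; rewrite ?zfz (negPf xz).
Qed.

(** The element w is realized as the fraction [tF / tG], where [F] is the product of the singletons
    of [A] and [G] the power t^q: the image of [F] has degree 2q in t. If w were the image of a
    polynomial [p], then ['X_[F]] and [p * 'X_[G]] would have the same image, and some monomial of
    [p] would be a perfect matching of [A]. *)
Lemma not_normal_cycles (K : fieldType) (R : realType) (P : 'rV[R]_n -> Prop) x y :
  ~~ fconnect f x y ->
  (forall p : 'rV[int]_n, lattice_point P p <-> exists i, p = indicator (W i)) ->
  ~ normal_polytope K P.
Proof.
move=> nxy latP normP; have [f_inj _ odd_f _] := hf.
pose A := [set z | fconnect f x z || fconnect f y z].
have A_f z : (f z \in A) = (z \in A) by rewrite !inE -!(same_fconnect1_r f_inj).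
(* The two odd lengths add up to an even number, so halving loses nothing. *)
pose q := #|A|./2.
have q2 : q.*2 = #|A|.
  rewrite even_halfK // (_ : A = [set z in fconnect f x] :|: [set z in fconnect f y]).
    rewrite cardsU (_ : _ :&: _ = set0).
      by rewrite cards0 subn0 !cardsE -/(order f x) -/(order f y) oddD !odd_f.
    apply/setP=> z; rewrite !inE; apply/negP=> /andP[xz yz]; move/negP: nxy; apply.
    by apply: connect_trans xz _; rewrite fconnect_sym.
  by apply/setP=> z; rewrite !inE.
have [iT WT] := (stW _).1 (stable_set0 e).
have [iP WP] := choice (fun z => (stW _).1 (stable_set1 hf z)).
have [iE WE] := choice (fun z => (stW _).1 (stable_set2 hf z)).
pose F : 'X_{1..m} := (\sum_(z in A) U_(iP z))%MM.
pose E : 'X_{1..m} := (\sum_(z in A) U_(iE z))%MM.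
pose G : 'X_{1..m} := (U_(iT) *+ q)%MM.
have degF : mdeg F = #|A|.
  by rewrite mdeg_sum (eq_bigr (fun=> 1%N)) ?sum1_card // => z _; rewrite mdeg1.
have degE : mdeg E = #|A|.
  by rewrite mdeg_sum (eq_bigr (fun=> 1%N)) ?sum1_card // => z _; rewrite mdeg1.
have degG : mdeg G = q by rewrite mdegMn mdeg1 mul1n.
have multF j : multiplicity W F j = (j \in A).
  rewrite multiplicity_sum -sum_eq_mem; apply: eq_bigr => z _.
  by rewrite multiplicity1 WP inE.
have multE j : multiplicity W E j = (j \in A).*2 by apply: multiplicity_edges.
have multG j : multiplicity W G j = 0%N.
  by rewrite /multiplicity big1 // => i; rewrite mulmnE mnm1E; case: eqP => // <-; rewrite WT inE.
pose a i := indicator (W i).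
have eq_sq : weight W (F + F)%MM = weight W (G + G + E)%MM.
  apply/weightP; split=> [|j]; first by rewrite !mdegD degF degE degG [(q + q)%N]addnn q2.
  by rewrite !multiplicityD multF multE multG addnn.
pose tF : ratfun K n := toric_map a 'X_[F]; pose tG : ratfun K n := toric_map a 'X_[G].
have ringP g : toric_ring K P g <-> exists p, g = toric_map a p by apply: toric_ring_map.
have tG_nz : tG != 0.
  rewrite /tG toric_mapX tofrac_eq0 -msupp_eq0 msuppX //.
have sq : tF ^+ 2 = tG ^+ 2 * toric_map a 'X_[E].
  rewrite /tF /tG -!rmorphXn -rmorphM /= !expr2 -!mpolyXD.
  exact: etrans (etrans (toric_mapX _ _ _) (congr1 _ (congr1 _ eq_sq))) (esym (toric_mapX _ _ _)).
have tFP : toric_ring K P tF by apply/ringP; exists 'X_[F].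
have tGP : toric_ring K P tG by apply/ringP; exists 'X_[G].
have /ringP[p tFG] : toric_ring K P (tF / tG).
  apply: normP => //; apply: (integral_sqrt _ _ _ tG_nz sq); apply/ringP.
  - by exists 0; rewrite rmorph0.
  - by exists 1; rewrite rmorph1.
  - by exists (- 'X_[E]); rewrite rmorphN.
have I_pG : toric_ideal K a ('X_[F] - p * 'X_[G]).
  by rewrite /toric_ideal rmorphB rmorphM /= -tFG divfK // subrr.
(* Either [F] occurs in [p * 'X_[G]], or it survives in the difference and then has there a
   companion of the same weight. *)
have [v v_pG vF] : exists2 v, v \in msupp (p * 'X_[G]) & weight W v = weight W F.
  have [F_pG|F_pG] := boolP (F \in msupp (p * 'X_[G])); first by exists F.
  have F_supp : F \in msupp ('X_[F] - p * 'X_[G]).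
    rewrite mcoeff_msupp mcoeffB mcoeffX eqxx.
    by move: F_pG; rewrite mcoeff_msupp negbK => /eqP->; rewrite subr0 oner_eq0.
  have [v [v_supp nvF eq_w]] := toric_ideal_msupp I_pG F_supp; exists v => //.
  move: v_supp; rewrite !mcoeff_msupp mcoeffB mcoeffX [F == v]eq_sym (negPf nvF) sub0r.
  by rewrite oppr_eq0.
move: v_pG; rewrite (perm_mem (msuppMX _ _)) => /mapP[u _ vE].
have [deg_u mult_u] := (weightP W v F).1 vF.
apply: (@no_perfect_matching u A x) => [j||j xj].
- by rewrite -multF -mult_u vE multiplicityD multG.
- by move: deg_u; rewrite vE mdegD degF degG -q2 -addnn => /addnI->; rewrite addnn.
- by rewrite inE; apply/orP; left.
Qed.
End Normality.

(** * No quadratic Groebner basis *)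

Section GroebnerObstruction.
Variables (K : fieldType) (n m : nat) (W : 'I_m -> {set 'I_n}) (le : rel 'X_{1..m}).
Hypothesis le_mo : monomial_order le.
Implicit Types u v w : 'X_{1..m}.

Local Notation a := (fun i => indicator (W i)).

(** Degrees below 2 are included because [quadratic] fixes the degree of a polynomial, which only
    bounds that of its initial monomial. *)
Definition quadratically_standard u : Prop :=
  forall w w', (w <= u)%MM -> (mdeg w <= 2)%N ->
    weight W w' = weight W w -> le w' w -> w' = w.

(** Otherwise the larger monomial [u] is the initial monomial of ['X_[u] - 'X_[v]], hence divisible
    by the initial monomial [w] of a basis element. This has degree at most 2, and the basis element
    contains another, smaller monomial of the weight of [w]. *)
Lemma quadratically_standard_unique u v :
  has_quadratic_groebner_basis le (toric_ideal K a) ->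
  quadratically_standard u -> quadratically_standard v ->
  weight W u = weight W v -> u = v.
Proof.
move=> [G [GI inG] G2]; wlog le_vu : u v / le v u => [th su sv eq_w|su _ eq_w].
  case/orP: (mo_total le_mo u v) => [le_uv|le_vu]; last exact: th.
  by apply/esym/th.
apply/eqP; apply: contraT => nuv.
have /inG[k [c [g [gG eq_u]]]] : initial_ideal (K := K) le (toric_ideal K a) 'X_[u].
  apply: generated_ideal_in; exists ('X_[u] - 'X_[v]), u; split=> //.
    exact: toric_ideal_binomial.
  split=> [|w].
    by rewrite mcoeff_msupp mcoeffB !mcoeffX eqxx [v == u]eq_sym (negPf nuv) subr0 oner_eq0.
  move/msuppB_le; rewrite mem_cat !msuppX !inE => /orP[] /eqP-> //.
  by case/orP: (mo_total le_mo u u).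
(* Comparing coefficients at [u] singles out one term of the sum, hence one generator dividing
   ['X_[u]]. *)
have [i ci] : exists i, u \in msupp (c i * g i).
  case: (pickP (fun i => u \in msupp (c i * g i))) => [i ui|no_i]; first by exists i.
  move: (congr1 (mcoeff u) eq_u); rewrite mcoeffX eqxx raddf_sum big1 /= => [/eqP|i _].
    by rewrite oner_eq0.
  by apply/eqP/negPn; rewrite -mcoeff_msupp no_i.
have [p [w [pG [w_p le_w] gi]]] := gG i.
move: ci; rewrite gi (perm_mem (msuppMX _ _)) => /mapP[r _ uE].
have [Ip p_nz] := GI p pG; have /allP/(_ p pG)/eqP size_p := G2.
have [w' [w'_p nw eq_w']] := toric_ideal_msupp Ip w_p.
case/eqP: nw; apply: su => //; last exact: le_w.
  by rewrite uE lem_addr.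
by rewrite -ltnS -[3%N]size_p msize_mdeg_lt.
Qed.

(** The weight fixes the degree, so a fibre is finite and totality of the order suffices. *)
Lemma fiber_minimum u : exists2 v, weight W v = weight W u &
  forall w, weight W w = weight W u -> le v w.
Proof.
pose I : finType := 'X_{1..m < (mdeg u).+1}.
pose P := fun b : I => weight W b == weight W u.
have lt_u w : weight W w = weight W u -> (mdeg w < (mdeg u).+1)%N.
  by move/weightP=> [-> _].
have le_refl : reflexive le by move=> w; case/orP: (mo_total le_mo w w).
have [b Pb min_b] := @extremumP _ I le (BMultinom (lt_u u erefl)) P (fun b : I => bmnm b)
  le_refl (mo_trans le_mo) (mo_total le_mo) (eqxx _).
exists b => [|w w_u]; first exact/eqP.
by apply: (min_b (BMultinom (lt_u w w_u))); apply/eqP.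
Qed.

(** Replacing [w] by [w'] inside [u] stays in the fibre, and compatibility of the order with
    products keeps it below [u]. *)
Lemma divisor_of_fiber_minimum u w w' :
  (forall v, weight W v = weight W u -> le u v) -> (w <= u)%MM ->
  weight W w' = weight W w -> le w' w -> w' = w.
Proof.
move=> min_u le_wu eq_w le_w'w.
pose r := (u - w)%MM; have uE : u = (w + r)%MM by rewrite addmC submK.
have le1 : le u (w' + r)%MM by apply: min_u; rewrite weightD eq_w -weightD -uE.
have le2 : le (w' + r)%MM u by rewrite [X in le _ X]uE; apply: mo_add.
apply: (@addIm _ r); rewrite -uE; apply: (mo_anti le_mo); by rewrite le1 le2.
Qed.

End GroebnerObstruction.

(** * The least monomial covering one cycle *)

Section CycleMinimum.
Variables (n : nat) (e : rel 'I_n) (f : 'I_n -> 'I_n).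
Hypothesis hf : odd_cycles (complement e) f.
Variables (m : nat) (W : 'I_m -> {set 'I_n}).
Hypotheses (W_inj : injective W) (stW : forall S, stable e S <-> exists i, W i = S).
Implicit Types (x y z : 'I_n) (u v w M N : 'X_{1..m}).

(** The witness takes P_x and every second edge of the cycle, starting with the edge from [f x] to
    [f (f x)]. *)
Lemma near_perfect_matching x : exists u,
  (forall j, multiplicity W u j = fconnect f x j) /\ (mdeg u).*2 = (order f x).+1.
Proof.
have [f_inj _ odd_f _] := hf.
have [iP WP] := choice (fun z => (stW _).1 (stable_set1 hf z)).
have [iE WE] := choice (fun z => (stW _).1 (stable_set2 hf z)).
pose q := (order f x)./2.
have q2 : order f x = q.*2.+1 by rewrite -[LHS]odd_double_half odd_f.
pose M k : 'X_{1..m} := (\sum_(i < k) U_(iE (iter i.*2.+1 f x)))%MM.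
have multM k j : multiplicity W (U_(iP x) + M k)%MM j = count_mem j (traject f x k.*2.+1).
  elim: k => [|k IHk].
    by rewrite /M big_ord0 addm0 multiplicity1 WP inE /= addn0 eq_sym.
  rewrite /M big_ord_recr -/(M k) addmA multiplicityD IHk.
  rewrite doubleS 2![in RHS]trajectSr -!cats1 -catA.
  rewrite [RHS]count_cat; congr (_ + _)%N; rewrite multiplicity1 WE !inE.
  set t := f (iter k.*2 f x); rewrite -[iter _ f x]/t /= -/t addn0.
  rewrite [t == j]eq_sym [f t == j]eq_sym.
  have [->|//] := eqVneq j t; rewrite eq_sym.
  by rewrite (negPf (iter_cycle_neq hf t (k := 1) isT)).
exists (U_(iP x) + M q)%MM; split=> [j|].
  by rewrite multM -q2 -/(orbit f x) count_uniq_mem ?orbit_uniq // -fconnect_orbit.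
rewrite mdegD mdeg1 mdeg_sum (eq_bigr (fun=> 1%N)) => [|i _]; last by rewrite mdeg1.
by rewrite sum_nat_const card_ord muln1 q2.
Qed.

Definition edges_of x M : Prop :=
  forall l, (0 < M l)%N -> exists2 z, fconnect f x z & W l = [set z; f z].

(** The least monomial [Y] of the weight of a near perfect matching is again a singleton times
    edges, by counting. Dividing the product [E] of all edges of the cycle by its edge part [M]
    leaves [N], which covers [y] twice and the other vertices of the cycle once. *)
Lemma cycle_minimum (le : rel 'X_{1..m}) x : monomial_order le ->
  exists y i M N,
  [/\ [/\ fconnect f x y, W i = [set y], edges_of x M & edges_of x N],
      forall v, weight W v = weight W (U_(i) + M)%MM -> le (U_(i) + M)%MM v,
      forall j, (multiplicity W M j + (j == y) = fconnect f x j)%N,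
      forall j, (multiplicity W N j = fconnect f x j + (j == y))%N &
      (mdeg M).*2.+1 = order f x /\ (mdeg N).*2 = (order f x).+1].
Proof.
move=> le_mo; have [u0 [mult_u0 deg_u0]] := near_perfect_matching x.
have [Y Yu0 minY] := fiber_minimum W le_mo u0.
have [degY multY] := (weightP W Y u0).1 Yu0.
have {degY}degY : (mdeg Y).*2 = (order f x).+1 by rewrite degY.
have {multY}multY j : multiplicity W Y j = fconnect f x j by rewrite multY.
have {minY}minY v : weight W v = weight W Y -> le Y v by rewrite Yu0; apply: minY.
pose C := [set z | fconnect f x z].
have cardC : #|C| = order f x by rewrite cardsE.
have sumY : (\sum_i Y i * #|W i| = order f x)%N.
  transitivity (\sum_i Y i * #|W i :&: [set: 'I_n]|)%N.
    by apply: eq_bigr => i _; rewrite setIT.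
  rewrite -sum_multiplicity -cardC -sum1_card [RHS]big_mkcond; apply: eq_big => // j.
    by rewrite inE.
  by move=> _; rewrite multY inE; case: (fconnect f x j).
have W_le2 i : (#|W i| <= 2)%N := stable_card_le2 hf (W_stable stW i).
(* Twice the degree exceeds the number of covered vertices by 1, so exactly one factor, with
   exponent 1, falls short of size 2, and by just one vertex. *)
have /eqP/sum_nat_eq1[i [_ Yi Yl]] : (\sum_i Y i * (2 - #|W i|) = 1)%N.
  apply/eqP; rewrite -(eqn_add2r (\sum_i Y i * #|W i|)%N) -big_split /= sumY add1n -degY.
  rewrite mdegE -muln2 big_distrl /=; apply/eqP/eq_bigr => i _.
  by rewrite -mulnDr subnK.
move/eqP: Yi; rewrite muln_eq1 => /andP[/eqP Yi /eqP Wi].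
have /eqP/cards1P[y Wy] : #|W i| = 1%N by have := W_le2 i; move: Wi; case: #|W i| => [|[|[]]].
pose M := (Y - U_(i))%MM; have YE : Y = (U_(i) + M)%MM by rewrite addmC U_addK ?Yi.
have edgeY l : (0 < Y l)%N -> #|W l| = 2%N -> exists2 z, fconnect f x z & W l = [set z; f z].
  move=> Yl_gt0 /(stable_card2 hf (W_stable stW l))[z Wl]; exists z => //.
  have : (0 < multiplicity W Y z)%N.
    by apply/multiplicity_gt0P; exists l; rewrite // Wl set21.
  by rewrite multY lt0b.
have edgesM : edges_of x M.
  move=> l; rewrite mnmBE mnm1E; have [<-|nil] := eqVneq i l; first by rewrite Yi.
  rewrite subn0 => Yl_gt0; apply: edgeY => //; apply/eqP; rewrite eqn_leq W_le2 -subn_eq0.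
  have : (Y l * (2 - #|W l|) == 0)%N by rewrite (Yl l) // eq_sym.
  by rewrite muln_eq0 => /orP[/eqP Yl0|//]; rewrite Yl0 in Yl_gt0.
have xy : fconnect f x y.
  have : (0 < multiplicity W Y y)%N.
    by apply/multiplicity_gt0P; exists i; rewrite ?Yi // Wy set11.
  by rewrite multY lt0b.
have multM j : (multiplicity W M j + (j == y) = fconnect f x j)%N.
  by rewrite -multY YE multiplicityD multiplicity1 Wy inE addnC.
have [iE WE] := choice (fun z => (stW _).1 (stable_set2 hf z)).
pose E : 'X_{1..m} := (\sum_(z in C) U_(iE z))%MM.
have f_inj : injective f by case: hf.
have C_f z : (f z \in C) = (z \in C) by rewrite !inE -(same_fconnect1_r f_inj).
have multE j : multiplicity W E j = (fconnect f x j).*2.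
  by rewrite (multiplicity_edges hf _ WE C_f) inE.
have degE : mdeg E = order f x.
  by rewrite -cardC mdeg_sum (eq_bigr (fun=> 1%N)) ?sum1_card // => z _; rewrite mdeg1.
have E_gt0 l : reflect (exists2 z, fconnect f x z & l = iE z) (0 < E l)%N.
  rewrite mnm_sumE lt0n sum_nat_eq0 negb_forall; apply: (iffP existsP) => [[z]|[z xz ->]].
    by rewrite negb_imply inE mnm1E => /andP[xz]; case: (iE z =P l) => // <- _; exists z.
  by exists z; rewrite inE xz mnm1E eqxx.
have leME : (M <= E)%MM.
  apply/mnm_lepP=> l; have [->//|Ml_gt0] := posnP (M l).
  have [z xz Wl] := edgesM l Ml_gt0.
  have El_gt0 : (0 < E l)%N by apply/E_gt0; exists z => //; apply: W_inj; rewrite WE.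
  (* The exponent of an edge in [M] is at most 1, because [M] covers its endpoint [z] at most
     once. *)
  apply: leq_trans El_gt0; apply: (@leq_trans (multiplicity W M z)).
    by rewrite /multiplicity (bigD1 l) /= ?leq_addr // Wl set21.
  by have := multM z; rewrite xz; case: (z == y); lia.
pose N := (E - M)%MM; have EE : E = (N + M)%MM by rewrite submK.
have degM : (mdeg M).*2.+1 = order f x.
  by move: degY; rewrite YE mdegD mdeg1 add1n doubleS => -[].
exists y, i, M, N; split=> //.
- split=> // l; rewrite mnmBE => /leq_trans-/(_ _ (leq_subr _ _))/E_gt0[z xz ->].
  by exists z.
- by rewrite -YE.
- move=> j; have := multE j; rewrite EE multiplicityD -addnn -{2}multM addnA addnAC.
  by move/addIn.
by split=> //; move: degE degM; rewrite EE mdegD; lia.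
Qed.

End CycleMinimum.

(** * Rigid monomials of degree 2 and the two standard monomials *)

Section NoQuadraticGroebnerBasis.
Variables (n : nat) (e : rel 'I_n) (f : 'I_n -> 'I_n).
Hypothesis hf : odd_cycles (complement e) f.
Variables (m : nat) (W : 'I_m -> {set 'I_n}).
Hypotheses (W_inj : injective W) (stW : forall S, stable e S <-> exists i, W i = S).
Implicit Types (x y z : 'I_n) (i j k l : 'I_m) (u v w M N : 'X_{1..m}).

Lemma mdeg2_U u : mdeg u = 2%N -> exists i j, u = (U_(i) + U_(j))%MM.
Proof.
move=> u2; have : mdeg u != 0%N by rewrite u2.
rewrite mdegE sum_nat_eq0 negb_forall => /existsP[i]; rewrite negb_imply -lt0n /= => ui.
have : mdeg (u - U_(i))%MM == 1%N.
  by rewrite -(eqn_add2r (mdeg U_(i)%MM)) -mdegD U_addK // u2 mdeg1.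
rewrite mdeg_eq1 => /existsP[j /eqP uj].
by exists i, j; rewrite addmC -uj U_addK.
Qed.

Lemma U_pair_cancel i j k l :
  weight W (U_(k) + U_(l))%MM = weight W (U_(i) + U_(j))%MM -> W k = W i ->
  (U_(k) + U_(l) = U_(i) + U_(j))%MM.
Proof.
move=> eq_w /W_inj ki; rewrite {}ki in eq_w *; congr (_ + U_(_))%MM; apply: W_inj.
have [_ eq_m] := (weightP W _ _).1 eq_w; apply/setP=> z.
by have := eq_m z; rewrite !multiplicityD !multiplicity1 => /addnI; do 2!case: (z \in _).
Qed.

(** Another way to cover the endpoints of two edges by two stable sets would produce a triangle or a
    square in the complement. *)
Lemma edge_pair_rigid i j k l :
  #|W i| = 2%N -> #|W j| = 2%N ->
  weight W (U_(k) + U_(l))%MM = weight W (U_(i) + U_(j))%MM ->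
  (U_(k) + U_(l) = U_(i) + U_(j))%MM.
Proof.
move=> Wi2 Wj2; have h_in t (u v : 'I_n) : u \in W t -> v \in W t -> u != v -> complement e u v.
  by have /stable_complementP := W_stable stW t; apply.
have sub_eq t p q : p != q -> p \in W t -> q \in W t -> W t = [set p; q].
  move=> npq pt qt; apply/esym/eqP; rewrite eqEcard subUset !sub1set pt qt cards2 npq.
  exact: (stable_card_le2 hf (W_stable stW t)).
have [p Wi] := stable_card2 hf (W_stable stW i) Wi2.
have [r Wj] := stable_card2 hf (W_stable stW j) Wj2.
have npq : p != f p by rewrite eq_sym (iter_cycle_neq hf p (k := 1)).
have nrs : r != f r by rewrite eq_sym (iter_cycle_neq hf r (k := 1)).
have pi : p \in W i by rewrite Wi set21.
have qi : f p \in W i by rewrite Wi set22.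
have rj : r \in W j by rewrite Wj set21.
have sj : f r \in W j by rewrite Wj set22.
wlog pk : k l / p \in W k => [th eq_w|eq_w].
  have [_ /(_ p)] := (weightP W _ _).1 eq_w; rewrite !multiplicityD !multiplicity1 pi.
  case: (boolP (p \in W k)) => [pk _|_]; first exact: th.
  case: (boolP (p \in W l)) => [pl _|//]; rewrite addmC; apply: th => //.
  by rewrite addmC.
have [_ eq_m] := (weightP W _ _).1 eq_w.
have {}eq_m z : ((z \in W k) + (z \in W l) = (z \in W i) + (z \in W j))%N.
  by have := eq_m z; rewrite !multiplicityD !multiplicity1.
case: (boolP (f p \in W k)) => [qk|qk].
  by apply: U_pair_cancel eq_w _; rewrite Wi; apply: sub_eq.
have := eq_m (f p); rewrite (negPf qk) qi; case: (boolP (f p \in W l)) => // ql.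
case: (boolP (f p \in W j)) => // qj _.
case: (boolP (p \in W l)) => [pl|pl].
  rewrite addmC; apply: U_pair_cancel; first by rewrite addmC.
  by rewrite Wi; apply: sub_eq.
have := eq_m p; rewrite pk pi (negPf pl); case: (boolP (p \in W j)) => // pj _.
(* From here on the two edges are disjoint, and [W k] contains [p] while [W l] contains [f p]. *)
have neq (t u : 'I_n) : t \in W j -> u \notin W j -> u != t by move=> tj; apply: contraNneq => ->.
have niW t : t \in W j -> t \notin W i.
  by move=> tj; rewrite Wi !inE ![t == _]eq_sym !(negPf (neq _ _ tj _)).
have hpq : complement e p (f p) by apply: (h_in i).
have hrs : complement e r (f r) by apply: (h_in j).
have sym := cycle_rel_sym hf.
have := eq_m (f r); have := eq_m r; rewrite rj sj (negPf (niW r rj)) (negPf (niW _ sj)).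
(* If [r] and [f r] fall into the same set there is a triangle, otherwise a square. *)
case: (boolP (r \in W k)) => rk; case: (boolP (r \in W l)) => // rl _;
  case: (boolP (f r \in W k)) => sk; case: (boolP (f r \in W l)) => // sl _.
- case: (no_triangle hf (x := p) (y := r) (z := f r)) => //.
    by apply: (h_in k) => //; apply: neq.
  by rewrite sym; apply: (h_in k) => //; apply: neq.
- case: (no_square hf (x := p) (y := f p) (z := f r) (t := r)) => //.
  + by apply: (h_in l) => //; apply: neq.
  + by rewrite sym.
  + by rewrite sym; apply: (h_in k) => //; apply: neq.
  + exact: neq.
  + exact: neq.
- case: (no_square hf (x := p) (y := f p) (z := r) (t := f r)) => //.
  + by apply: (h_in l) => //; apply: neq.
  + by rewrite sym; apply: (h_in k) => //; apply: neq.
  + exact: neq.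
  + exact: neq.
- case: (no_triangle hf (x := f p) (y := r) (z := f r)) => //.
    by apply: (h_in l) => //; apply: neq.
  by rewrite sym; apply: (h_in l) => //; apply: neq.
Qed.

(** A further element of the set containing [b] would be a neighbour of [b] in the complement, but
    by multiplicity it would come from [W j]. *)
Lemma singleton_pair_rigid b i j k l :
  W i = [set b] -> (forall z, z \in W j -> ~~ complement e b z) ->
  weight W (U_(k) + U_(l))%MM = weight W (U_(i) + U_(j))%MM ->
  (U_(k) + U_(l) = U_(i) + U_(j))%MM.
Proof.
move=> Wi Wj; wlog bk : k l / b \in W k => [th eq_w|eq_w].
  have [_ eq_m] := (weightP W _ _).1 eq_w.
  have := eq_m b; rewrite !multiplicityD !multiplicity1 Wi set11.
  case: (boolP (b \in W k)) => [bk _|_]; first exact: th.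
  case: (boolP (b \in W l)) => [bl _|//]; rewrite addmC; apply: th => //.
  by rewrite addmC.
have [_ eq_m] := (weightP W _ _).1 eq_w.
apply: U_pair_cancel eq_w _; rewrite Wi; apply/eqP; rewrite eqEsubset sub1set bk andbT.
apply/subsetP=> z zk; rewrite inE; apply: contraT => nzb.
have := eq_m z; rewrite !multiplicityD !multiplicity1 zk Wi inE (negPf nzb) /=.
case: (boolP (z \in W j)) => // zj _; case/negP: (Wj z zj).
by have /stable_complementP := W_stable stW k; apply; rewrite // eq_sym.
Qed.

(** A divisor of degree 2 is rigid if it consists of two edges, of P_b twice, or of P_b and an edge
    of the other cycle. In the remaining case, P_b with an edge of [M], it divides the least
    monomial P_b [M]. *)
Lemma quadratically_standard_edges (le : rel 'X_{1..m}) x y b i M N :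
  monomial_order le -> ~~ fconnect f x y -> fconnect f y b -> W i = [set b] ->
  edges_of f W x N -> edges_of f W y M ->
  (forall v, weight W v = weight W (U_(i) + M)%MM -> le (U_(i) + M)%MM v) ->
  quadratically_standard W le (N + (U_(i) + (U_(i) + M)))%MM.
Proof.
move=> le_mo nxy yb Wi Nx My min_i w w' le_w w_le2 eq_w le_w'w.
have [f_inj _ _ _] := hf; have [eq_d eq_m] := (weightP W w' w).1 eq_w.
case: (ltngtP (mdeg w) 1%N) => [w0|w_gt1|w1].
- have /eqP w00 : w == 0%MM by rewrite -mdeg_eq0 -leqn0.
  by apply/eqP; rewrite w00 -mdeg_eq0 eq_d w00 mdeg0.
- have w2 : mdeg w = 2%N by apply/eqP; rewrite eqn_leq w_le2.
  have w'2 : mdeg w' = 2%N by rewrite eq_d.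
  have [k [l wE]] := mdeg2_U w2; have [k' [l' w'E]] := mdeg2_U w'2.
  have supp t : (0 < w t)%N -> [\/ (0 < N t)%N, t = i | (0 < M t)%N].
    move/mnm_lepP/(_ t): le_w => le_t w_t; have := leq_trans w_t le_t.
    rewrite !mnmDE !addn_gt0 mnm1E => /or4P[Nt|||Mt]; first exact: Or31; last exact: Or33.
      by case: (i =P t) => // -> _; apply: Or32.
    by case: (i =P t) => // -> _; apply: Or32.
  have edge2 t : (0 < N t)%N \/ (0 < M t)%N -> #|W t| = 2%N.
    by case=> [/Nx|/My] [z _ ->]; apply: (card_set2_next hf).
  have with_i t : (0 < w t)%N -> w = (U_(i) + U_(t))%MM -> w' = w.
    move=> wt wE'; case: (supp t wt) => [Nt|ti|Mt].
    + rewrite w'E wE' in eq_w *; apply: (singleton_pair_rigid Wi _ eq_w) => z zt.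
      apply: contraNN nxy => /(cycle_rel_connect hf) bz.
      have xz : fconnect f x z.
        have [z0 xz0 Wt] := Nx t Nt; move: zt; rewrite Wt => /set2P[] -> //.
        by rewrite -(same_fconnect1_r f_inj).
      apply: connect_trans xz _; rewrite fconnect_sym //.
      exact: connect_trans yb bz.
    + rewrite w'E wE' ti in eq_w *; apply: (singleton_pair_rigid Wi _ eq_w) => z.
      by rewrite Wi inE => /eqP->; rewrite /complement eqxx.
    + apply: (divisor_of_fiber_minimum le_mo min_i) => //.
      rewrite wE'; apply/mnm_lepP=> s; rewrite !mnmDE leq_add2l mnm1E.
      by case: eqP => // <-.
  have wk : (0 < w k)%N by rewrite wE mnmDE mnm1E eqxx.
  have wl : (0 < w l)%N by rewrite wE mnmDE !mnm1E eqxx addn1.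
  have edge t : (0 < w t)%N -> t != i -> #|W t| = 2%N.
    move=> /supp[Nt|->|Mt]; rewrite ?eqxx // => _; apply: edge2; first by left.
    by right.
  have [ki|ki] := eqVneq k i; first by apply: (with_i l) => //; rewrite wE ki.
  have [li|li] := eqVneq l i; first by apply: (with_i k) => //; rewrite wE li addmC.
  rewrite w'E wE in eq_w *; apply: edge_pair_rigid eq_w; exact: edge.
- have w'1 : mdeg w' == 1%N by rewrite eq_d w1.
  move/eqP: w1; rewrite mdeg_eq1 => /existsP[k /eqP wE].
  move: w'1; rewrite mdeg_eq1 => /existsP[k' /eqP w'E].
  rewrite wE w'E; congr (U_(_))%MM; apply: W_inj; apply/setP=> z.
  by have := eq_m z; rewrite wE w'E !multiplicity1; do 2!case: (z \in _).
Qed.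

Lemma no_quadratic_groebner_basis (K : fieldType) (le : rel 'X_{1..m}) x y :
  monomial_order le -> ~~ fconnect f x y ->
  ~ has_quadratic_groebner_basis le (toric_ideal K (fun i => indicator (W i))).
Proof.
move=> le_mo nxy gb; have [f_inj _ _ _] := hf.
have [b [i [M [N [[xb Wi Mx Nx] minx multM multN [degM degN]]]]]] :=
  cycle_minimum hf W_inj stW x le_mo.
have [c [j [M' [N' [[yc Wj My Ny] miny multM' multN' [degM' degN']]]]]] :=
  cycle_minimum hf W_inj stW y le_mo.
have nyx : ~~ fconnect f y x by rewrite fconnect_sym.
have std1 := quadratically_standard_edges le_mo nxy yc Wj Nx My miny.
have std2 := quadratically_standard_edges le_mo nyx xb Wi Ny Mx minx.
have nij : i != j.
  apply: contraNneq nxy => ij; have : b \in W j by rewrite -ij Wi set11.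
  by rewrite Wj inE => /eqP bc; apply: connect_trans xb _; rewrite bc fconnect_sym.
have eq_w : weight W (N + (U_(j) + (U_(j) + M')))%MM = weight W (N' + (U_(i) + (U_(i) + M)))%MM.
  apply/weightP; split=> [|z]; first by rewrite !mdegD !mdeg1; lia.
  rewrite !multiplicityD !multiplicity1 Wi Wj !inE multN multN'.
  by rewrite -multM -multM'; case: (z == b); case: (z == c) => /=; lia.
(* The exponents of the singleton [W j] differ: at least 2 on one side, and 0 on the other, where
   the only singleton is [W i]. *)
have /mnmP/(_ j) := quadratically_standard_unique le_mo gb std1 std2 eq_w.
have Nj (P : 'X_{1..m}) z : edges_of f W z P -> P j = 0%N.
  move=> Pz; case: (posnP (P j)) => // /Pz[t _ Wjt].
  by have := card_set2_next hf t; rewrite -Wjt Wj cards1.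
by rewrite !mnmDE !mnm1E eqxx (negPf nij) (Nj _ _ Ny) (Nj _ _ Mx); lia.
Qed.

End NoQuadraticGroebnerBasis.

Local Close Scope ring_scope.

Theorem theorem3p6 (K : fieldType) (R : realType) (n : nat) (e : rel 'I_n)
    (e_sym : ssrbool.symmetric e) (e_irr : irreflexive e)
    (e_holes : two_disjoint_odd_holes (complement e)) :
  independence_number e = 2 /\
  (forall (m : nat) (a : 'I_m -> 'rV[int]_n),
     lattice_enum (stable_set_polytope R e) a ->
     generated_by_quadratic_binomials (toric_ideal K a) /\
     (forall le : rel 'X_{1..m}, monomial_order le ->
        ~ has_quadratic_groebner_basis le (toric_ideal K a))) /\
  ~ normal_polytope K (stable_set_polytope R e).
Proof.
have [f [x [y [hf nxy]]]] := two_disjoint_odd_holes_cycles e_holes.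
split; first exact: (independence_number_cycles hf x).
split=> [m a latP|].
  have [W [aE W_inj stW]] := stable_set_polytope_enum_stable latP.
  rewrite {}aE in latP *; split=> [|le le_mo].
    exists (@quadratic_relation n K m W); split=> [g [] //|].
    apply: toric_ideal_generated => [g [] //|u v].
    exact: (binomial_generated hf K W_inj stW).
  exact: (no_quadratic_groebner_basis hf W_inj stW le_mo nxy).
(* Normality does not mention an enumeration of the lattice points, so one is chosen here. *)
have [m [a latP]] := stable_set_polytope_enum R e.
have [W [aE _ stW]] := stable_set_polytope_enum_stable latP.
by apply: (not_normal_cycles hf stW nxy) => p; rewrite (proj2 latP) aE.
Qed.
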